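(* Let $\Psi$ be an index function such that $$\frac1\alpha\bigl(T_\alpha(x^\dagger;Ax^\dagger)-T_\alpha(x_\alpha;Ax^\dagger)\bigr)\le\Psi(\alpha)\quad\text{for all }\alpha>0 .$$ Then $$J(x^\dagger)-J(x_\alpha)\le 2\Psi(\alpha)\quad\text{for all }\alpha>0 .$$
   Context: Setting. $X$ is an infinite-dimensional Banach space, $H$ an infinite-dimensional Hilbert space with norm $\|\cdot\|$, and $A:X\to H$ a bounded linear operator with non-closed range. $J:X\to[0,\infty]$ is a proper convex functional, lower semi-continuous with respect to weak (or weak$^*$) sequential convergence, such that for every $c\ge0$ the sublevel set $\{x\in X: J(x)\le c\}$ is weakly (or weak$^*$) sequentially compact. $y\in \mathrm{range}(A)$, and $Ax=y$ has at least one solution with finite penalty value. $x^\dagger\in X$ denotes a $J$-minimizing solution: $Ax^\dagger=y$ and $J(x^\dagger)=\min\{J(x): x\in X, Ax=y\}<\infty$. Tikhonov functional: for $\alpha>0$ and $v\in H$, $T_\alpha(x;v):=\frac12\|Ax-v\|^2+\alpha J(x)$, $x\in X$. For each $\alpha>0$, $x_\alpha$ is an (arbitrarily selected) minimizer of $T_\alpha(\cdot;y)$ over $X$. An index function is a function $\varphi:(0,\infty)\to(0,\infty)$ that is continuous, strictly increasing and satisfies $\lim_{t\to+0}\varphi(t)=0$. *)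

(* Defs.v *)
From HB Require Import structures.
From mathcomp Require Import all_boot all_order all_algebra.
From mathcomp Require Import all_classical all_reals all_analysis.

Set Implicit Arguments.
Unset Strict Implicit.
Unset Printing Implicit Defensive.

Import Order.TTheory GRing.Theory Num.Theory.
Import numFieldNormedType.Exports.

Local Open Scope classical_set_scope.
Local Open Scope ring_scope.

Definition infinite_dimensional (R : realType) (V : lmodType R) : Prop :=
  forall (n : nat) (b : 'I_n -> V),
    ~ (forall x : V, exists c : 'I_n -> R, x = \sum_(i < n) c i *: b i).

(* On a [completeNormedModType R] this says that the space is a (real) Hilbert
   space: its norm is induced by an inner product. *)
Definition hilbertian (R : realType) (H : normedModType R) : Prop :=
  exists dot : {dot H for idfun}, forall x : H, `|x| ^+ 2 = dot x x.

Definition weakly_converges (R : realType) (X : normedModType R)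
    (u : nat -> X) (x : X) : Prop :=
  forall f : {scalar X}, continuous f -> f (u n) @[n --> \oo] --> f x.

(* The pairing [p] identifies [X] isometrically with the dual of [Z]: the map
   [x |-> p x] is linear, takes values in the continuous functionals, is onto
   them, and the norm of [x] is the operator norm of [p x]. *)
Definition is_dual_pairing (R : realType) (X Z : normedModType R)
    (p : X -> {scalar Z}) : Prop :=
  [/\ forall (a : R) (x y : X) (z : Z), p (a *: x + y) z = a * p x z + p y z,
      forall x : X, continuous (p x),
      forall f : {scalar Z}, continuous f -> exists x : X, p x =1 f
    & forall x : X, `|x| = sup [set `|p x z| | z in [set z | `|z| <= 1]]].

Definition weakstar_converges (R : realType) (X Z : normedModType R)
    (p : X -> {scalar Z}) (u : nat -> X) (x : X) : Prop :=
  forall z : Z, p (u n) z @[n --> \oo] --> p x z.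

(* The weak* convergence depends on the chosen predual, which is therefore part
   of the data. *)
Variant weak_or_weakstar (R : realType) (X : normedModType R) : Type :=
| Weak
| WeakStar (Z : normedModType R) (p : X -> {scalar Z}) of is_dual_pairing p.

Definition converges (R : realType) (X : normedModType R)
    (tau : weak_or_weakstar X) (u : nat -> X) (x : X) : Prop :=
  match tau with
  | Weak => weakly_converges u x
  | WeakStar _ p _ => weakstar_converges p u x
  end.

Definition seq_compact (R : realType) (X : normedModType R)
    (tau : weak_or_weakstar X) (S : set X) : Prop :=
  forall u : nat -> X, (forall n, S (u n)) ->
    exists2 k : nat -> nat, increasing_seq k &
      exists2 x : X, S x & converges tau (u \o k) x.

Section extended_real_functionals.
Local Open Scope ereal_scope.

Definition proper_functional (R : realType) (X : normedModType R) (J : X -> \bar R) :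
  Prop := (forall x, -oo < J x) /\ (exists x, J x < +oo).

(* The products follow the convention [0 * +oo = 0]. *)
Definition convex_functional (R : realType) (X : normedModType R)
    (J : X -> \bar R) : Prop :=
  forall (t : R) (x y : X), (0 <= t <= 1)%R ->
    J (t *: x + (1 - t) *: y)%R <= t%:E * J x + (1 - t)%:E * J y.

Definition seq_lsc (R : realType) (X : normedModType R)
    (tau : weak_or_weakstar X) (J : X -> \bar R) : Prop :=
  forall (u : nat -> X) (x : X), converges tau u x ->
    J x <= limn_einf (J \o u).

Definition minimizer (R : realType) (X : Type) (F : X -> \bar R) (x : X) :
  Prop := forall z : X, F x <= F z.

Definition minimizing_solution (R : realType) (X H : normedModType R)
    (A : X -> H) (J : X -> \bar R) (y : H) (x : X) : Prop :=
  [/\ A x = y, forall z : X, A z = y -> J x <= J z & J x < +oo].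

Definition tikhonov (R : realType) (X H : normedModType R)
    (A : X -> H) (J : X -> \bar R) (alpha : R) (v : H) (x : X) : \bar R :=
  (2^-1 * `|A x - v| ^+ 2)%:E + alpha%:E * J x.

End extended_real_functionals.

(* Index functions live on the open half-line; the values of [phi] at
   nonpositive arguments are unconstrained. *)
Definition index_function (R : realType) (phi : R -> R) : Prop :=
  [/\ forall t, 0 < t -> 0 < phi t,
      forall t, 0 < t -> {for t, continuous phi},
      forall s t, 0 < s -> s < t -> phi s < phi t
    & phi t @[t --> 0^'+] --> 0].

(* Main.v *)
(* Comparing x_alpha with the segment towards x^dagger, convexity of J gives
   |A x_alpha - y|^2 <= alpha (J x^dagger - J x_alpha).  Hence the residual term
   |A x_alpha - y|^2 / (2 alpha) that separates J x^dagger - J x_alpha from the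
   quantity bounded by Psi is at most half of J x^dagger - J x_alpha. *)
Require Import Defs.
From HB Require Import structures.
From mathcomp Require Import all_boot all_order all_algebra.
From mathcomp Require Import all_classical all_reals all_analysis.
From mathcomp Require Import lra.

Import Order.TTheory GRing.Theory Num.Theory.
Import numFieldNormedType.Exports.

Local Open Scope classical_set_scope.
Local Open Scope ring_scope.

(** Cancelling [r] and dividing by [t] leaves [(2 - t) * r <= b]; then [t] tends to 0. An explicit
    small [t] replaces the limit. *)
Lemma le_of_quadratic_bound (R : realFieldType) (r b : R) : 0 <= r ->
  (forall t, 0 < t -> t < 1 -> r <= (1 - t) ^+ 2 * r + t * b) -> 2 * r <= b.
Proof.
move=> r_ge0 Hr; rewrite leNgt; apply/negP => br.
have d_gt0 : 0 < 2 * r - b by rewrite subr_gt0.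
have den_gt0 : 0 < (2 * r - b) + r + 1 by lra.
have den_neq0 := lt0r_neq0 den_gt0.
(* With [d = 2 * r - b], this choice gives [t * r = d - t * d - t < d], against [d <= t * r]; the
   summand 1 keeps [t < 1] even when [r = 0]. *)
pose t := (2 * r - b) / ((2 * r - b) + r + 1).
have t_gt0 : 0 < t by rewrite divr_gt0.
have t_lt1 : t < 1 by rewrite ltr_pdivrMr// mul1r; lra.
have tden : t * ((2 * r - b) + r + 1) = 2 * r - b by rewrite /t mulfVK.
have d_le : t * (2 * r - b) <= t * (t * r) by have := Hr t t_gt0 t_lt1; lra.
rewrite ler_pM2l// in d_le.
have : 0 < t * (2 * r - b) by rewrite mulr_gt0.
by lra.
Qed.

(** An infinite penalty at [x] would make its Tikhonov value infinite, while that of [z] is finite.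
    This licenses real arithmetic on [fine (J x)]. *)
Lemma tikhonov_minimizer_fin_num {R : realType} {X H : normedModType R}
    {A : X -> H} {J : X -> \bar R} {alpha : R} {v : H} {x z : X} :
  (forall w, (0 <= J w)%E) -> 0 < alpha ->
  minimizer (tikhonov A J alpha v) x -> (J z < +oo)%E -> J x \is a fin_num.
Proof.
move=> J_ge0 alpha_gt0 x_min Jz; rewrite ge0_fin_numE// ltNge leye_eq.
apply/negP => /eqP Jx; have := x_min z; rewrite /tikhonov.
have /fineK <- : J z \is a fin_num by rewrite ge0_fin_numE.
by rewrite Jx gt0_muley ?lte_fin// addey// -EFinM -EFinD leye_eq.
Qed.

(** Comparing [x] with [z] alone yields only twice this bound, too weak to absorb the residual;
    small steps from [x] towards [z] gain the factor 2. *)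
Lemma tikhonov_minimizer_residual_le {R : realType} {X H : normedModType R}
    {A : {linear X -> H}} {J : X -> \bar R} {alpha : R} {x z : X} :
  convex_functional J -> (forall w, (0 <= J w)%E) -> 0 < alpha ->
  minimizer (tikhonov A J alpha (A z)) x -> (J z < +oo)%E ->
  `|A x - A z| ^+ 2 <= alpha * (fine (J z) - fine (J x)).
Proof.
move=> J_convex J_ge0 alpha_gt0 x_min Jz.
have /fineK Jx := tikhonov_minimizer_fin_num J_ge0 alpha_gt0 x_min Jz.
have /fineK {}Jz : J z \is a fin_num by rewrite ge0_fin_numE.
set n2 := `|A x - A z| ^+ 2.
suff : 2 * (2^-1 * n2) <= alpha * (fine (J z) - fine (J x)) by rewrite mulVKf.
apply: le_of_quadratic_bound => [|t t_gt0 t_lt1].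
  by rewrite mulr_ge0 ?invr_ge0// sqr_ge0.
pose w := t *: z + (1 - t) *: x.
have t01 : 0 <= t <= 1 by rewrite !ltW.
(* The data are [A z], so by linearity the residual shrinks by exactly [1 - t] along the segment. *)
have Aw : `|A w - A z| ^+ 2 = (1 - t) ^+ 2 * n2.
  have -> : A w - A z = (1 - t) *: (A x - A z).
    by rewrite linearD !linearZ/= scalerBr [(1 - t) *: A z]scalerBl scale1r opprB
      addrCA addrA.
  by rewrite normrZ exprMn real_normK// num_real.
have := x_min w; rewrite /tikhonov Aw -Jx => xw.
have := J_convex t z x t01; rewrite -/w -Jx -Jz => Jw.
have : ((2^-1 * n2)%:E + alpha%:E * (fine (J x))%:E <=
    (2^-1 * ((1 - t) ^+ 2 * n2))%:E +
    alpha%:E * (t%:E * (fine (J z))%:E + (1 - t)%:E * (fine (J x))%:E))%E.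
  by apply: (le_trans xw); rewrite leeD2l// lee_pmul2l// lte_fin.
(* Cancelling [alpha * J x] leaves the quadratic bound with [b = alpha * (J z - J x)]. *)
by rewrite -!(EFinM, EFinD) lee_fin; lra.
Qed.

Theorem proposition1 (R : realType) (X H : completeNormedModType R)
    (X_infdim : infinite_dimensional X)
    (H_hilbert : hilbertian H) (H_infdim : infinite_dimensional H)
    (A : {linear X -> H}) (A_bounded : bounded_near A (nbhs 0))
    (A_nonclosed : ~ closed (range A))
    (tau : weak_or_weakstar X)
    (J : X -> \bar R) (J_ge0 : forall x : X, (0 <= J x)%E)
    (J_proper : proper_functional J) (J_convex : convex_functional J)
    (J_lsc : seq_lsc tau J)
    (J_compact : forall c : R, 0 <= c ->
       seq_compact tau [set x : X | (J x <= c%:E)%E])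
    (y : H) (y_range : range A y)
    (y_finite : exists x : X, A x = y /\ (J x < +oo)%E)
    (xdag : X) (xdag_min : minimizing_solution A J y xdag)
    (x_ : R -> X)
    (x_min : forall alpha : R, 0 < alpha ->
       minimizer (tikhonov A J alpha y) (x_ alpha))
    (Psi : R -> R) (Psi_index : index_function Psi)
    (Psi_bound : forall alpha : R, 0 < alpha ->
       ((alpha^-1)%:E * (tikhonov A J alpha (A xdag) xdag
                         - tikhonov A J alpha (A xdag) (x_ alpha))
          <= (Psi alpha)%:E)%E) :
  forall alpha : R, 0 < alpha ->
    (J xdag - J (x_ alpha) <= (2 * Psi alpha)%:E)%E.
Proof.
move=> alpha alpha_gt0.
have [Axdag _ Jxdag] := xdag_min.
have min_alpha := x_min alpha alpha_gt0.
have bound := Psi_bound alpha alpha_gt0.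
rewrite -Axdag in min_alpha.
have := tikhonov_minimizer_residual_le J_convex J_ge0 alpha_gt0 min_alpha Jxdag.
have /fineK Jx := tikhonov_minimizer_fin_num J_ge0 alpha_gt0 min_alpha Jxdag.
have /fineK {}Jxdag : J xdag \is a fin_num by rewrite ge0_fin_numE.
move: bound; rewrite /tikhonov subrr normr0 -Jx -Jxdag /=.
rewrite -!(EFinM, EFinD, EFinB) !lee_fin ler_pdivrMl// expr0n/= mulr0.
(* With [D = J xdag - J (x_ alpha)] and [n2] the squared residual,
   [alpha * D - n2 / 2 <= alpha * Psi alpha] and [n2 <= alpha * D]. *)
move=> bound residual; rewrite -(ler_pM2l alpha_gt0).
by lra.
Qed.
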